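(* Let $\Vert\cdot\Vert$ be any norm on $\mathbb{R}^d$ with dual norm $\Vert\cdot\Vert_\ast$, and define on matrices $H\in\mathbb{R}^{d\times d}$ the matrix norm $$\Vert H\Vert := \max_{\Vert x\Vert\le 1}\Vert Hx\Vert_\ast .$$ Let $f\colon\mathbb{R}^d\to\mathbb{R}$ be twice differentiable and let $L>0$. Then $f$ is $L$-smooth with respect to $\Vert\cdot\Vert$ if and only if $\Vert\nabla^2 f(x)\Vert\le L$ for all $x\in\mathbb{R}^d$.
   Context: For a norm $\Vert\cdot\Vert$ on $\mathbb{R}^d$, the dual norm is $\Vert z\Vert_\ast = \max_{\Vert x\Vert\le 1}\langle z,x\rangle$. A differentiable function $f\colon\mathbb{R}^d\to\mathbb{R}$ is called $L$-smooth with respect to $\Vert\cdot\Vert$ (for a constant $L>0$) if $\Vert\nabla f(x')-\nabla f(x)\Vert_\ast\le L\Vert x'-x\Vert$ for all $x,x'\in\mathbb{R}^d$. *)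

(* Defs.v *)
From HB Require Import structures.
From mathcomp Require Import all_boot all_order all_algebra.
From mathcomp Require Import boolp classical_sets reals topology normedtype derive.

Set Implicit Arguments.
Unset Strict Implicit.
Unset Printing Implicit Defensive.

Import Order.TTheory GRing.Theory Num.Theory.
Import numFieldNormedType.Exports.

Local Open Scope classical_set_scope.
Local Open Scope ring_scope.

(* Vectors of R^d are columns, so that the action of a matrix is H *m x. The
   library's topology on 'cV[R]_d is that of the sup norm; as all norms on R^d
   are equivalent, [differentiable] does not depend on that choice, and the
   norm N of the statement is a separate, arbitrary function. *)

(* Nonnegativity follows from these three axioms. *)
Record is_norm (R : realType) (d : nat) (N : 'cV[R]_d -> R) : Prop := IsNorm {
  is_norm_triangle : forall x y, N (x + y) <= N x + N y ;
  is_norm_homogeneous : forall (a : R) x, N (a *: x) = `|a| * N x ;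
  is_norm_definite : forall x, N x = 0 -> x = 0
}.

Definition inner (R : realType) (d : nat) (z x : 'cV[R]_d) : R :=
  \sum_(i < d) z i 0 * x i 0.

(* When N is a norm, its unit ball is compact and nonempty, so the suprema in
   [dual_norm] and [mx_dual_norm] are finite and are in fact maxima. *)
Definition dual_norm (R : realType) (d : nat) (N : 'cV[R]_d -> R)
    (z : 'cV[R]_d) : R :=
  sup [set inner z x | x in [set x | N x <= 1]].

Definition mx_dual_norm (R : realType) (d : nat) (N : 'cV[R]_d -> R)
    (H : 'M[R]_d) : R :=
  sup [set dual_norm N (H *m x) | x in [set x | N x <= 1]].

Definition gradient (R : realType) (d : nat) (f : 'cV[R]_d -> R)
    (x : 'cV[R]_d) : 'cV[R]_d :=
  \col_i 'D_(delta_mx i 0) f x.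

(* The Jacobian matrix of the gradient: entry (i, j) is the derivative in
   direction j of the i-th partial derivative of f. *)
Definition hessian (R : realType) (d : nat) (f : 'cV[R]_d -> R)
    (x : 'cV[R]_d) : 'M[R]_d :=
  \matrix_(i, j) 'D_(delta_mx j 0) (fun y => gradient f y i 0) x.

(* The second derivative need not be continuous. *)
Definition twice_differentiable (R : realType) (d : nat)
    (f : 'cV[R]_d -> R) : Prop :=
  (forall x, differentiable f x) /\ (forall x, differentiable (gradient f) x).

Definition L_smooth (R : realType) (d : nat) (N : 'cV[R]_d -> R) (L : R)
    (f : 'cV[R]_d -> R) : Prop :=
  (forall x, differentiable f x) /\
  (forall x x', dual_norm N (gradient f x' - gradient f x) <= L * N (x' - x)).

(* Main.v *)
(* For fixed y, Hölder's inequality turns both sides into statements about the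
   scalar functions F_y(x) = <grad f(x), y>, whose derivative at x along v is
   <hess f(x) v, y>. The Hessian bound gives the Lipschitz bound by the mean
   value theorem along segments; conversely the difference quotients of F_y
   along v are at most L N(v) N(y), and so is their limit. As suprema are only
   meaningful for bounded sets, one also needs that N dominates the sup norm,
   by compactness of the unit sphere of the latter. *)
Require Import Defs.
From mathcomp Require Import all_boot all_order all_algebra.
From mathcomp Require Import boolp classical_sets functions reals topology.
From mathcomp Require Import normedtype derive.
Import Order.TTheory GRing.Theory Num.Theory.
Import numFieldNormedType.Exports.
Local Open Scope ring_scope.

Section Inner.
Context {R : realType} {d : nat}.
Implicit Types x y z : 'cV[R]_d.

Lemma innerZl a z x : inner (a *: z) x = a * inner z x.
Proof. by rewrite mulr_sumr; apply: eq_bigr => i _; rewrite mxE mulrA. Qed.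

Lemma innerZr a z x : inner z (a *: x) = a * inner z x.
Proof. by rewrite mulr_sumr; apply: eq_bigr => i _; rewrite mxE mulrCA. Qed.

Lemma innerBl y z x : inner (y - z) x = inner y x - inner z x.
Proof. by rewrite -sumrB; apply: eq_bigr => i _; rewrite !mxE mulrBl. Qed.

End Inner.

Lemma ler_coord_mx_norm {R : realType} {m n : nat} (A : 'M[R]_(m, n)) i j :
  `|A i j| <= `|A|.
Proof.
by rewrite [leRHS]/Num.norm/= mx_normrE; exact: (le_bigmax _ _ (i, j)).
Qed.

(** Lets extrema over row vectors, the setting of [EVT_min_rV], be transferred to columns. *)
Lemma mx_norm_trmx {R : realType} {m n : nat} (A : 'M[R]_(m, n)) :
  `|A^T| = `|A|.
Proof.
suff le_trmx p q (B : 'M[R]_(p, q)) : `|B^T| <= `|B|.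
  by apply/le_anti; rewrite le_trmx -{1}(trmxK A) le_trmx.
rewrite [leLHS]/Num.norm/= mx_normrE; apply: bigmax_le => // -[i j] _.
by rewrite mxE ler_coord_mx_norm.
Qed.

Section DualNorm.
Context {R : realType} {d : nat} {N : 'cV[R]_d -> R}.
Hypothesis hN : is_norm N.
Implicit Types x y z : 'cV[R]_d.

Lemma norm0 : N 0 = 0.
Proof. by rewrite -(scale0r 0) (is_norm_homogeneous hN) normr0 mul0r. Qed.

Lemma normN x : N (- x) = N x.
Proof. by rewrite -scaleN1r (is_norm_homogeneous hN) normrN1 mul1r. Qed.

Lemma norm_ge0 x : 0 <= N x.
Proof.
have := is_norm_triangle hN x (- x).
by rewrite subrr norm0 normN -mulr2n pmulrn_lge0.
Qed.

Lemma norm_gt0 x : x != 0 -> 0 < N x.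
Proof.
move=> x0; rewrite lt_neqAle norm_ge0 andbT eq_sym.
by apply: contra_neq x0; exact: is_norm_definite.
Qed.

Lemma norm_normalize x : x != 0 -> N ((N x)^-1 *: x) = 1.
Proof.
move=> /norm_gt0 x0.
by rewrite (is_norm_homogeneous hN) gtr0_norm ?invr_gt0// mulVf ?gt_eqF.
Qed.

Lemma norm_le_mx_norm : exists2 K, 0 < K & forall x, N x <= K * `|x|.
Proof.
(* The sum comes from expanding [x] in the standard basis; the 1 keeps the constant positive even
   when [d] is 0. *)
exists (1 + \sum_i N (delta_mx i 0)).
  by rewrite ltr_wpDr// sumr_ge0// => i _; exact: norm_ge0.
move=> x; rewrite mulrDl mul1r mulr_suml ler_wpDl//.
have {1}-> : x = \sum_i x i 0 *: delta_mx i 0.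
  by rewrite {1}(matrix_sum_delta x); apply: eq_bigr => i _; rewrite big_ord1.
apply: (@le_trans _ _ (\sum_i N (x i 0 *: delta_mx i 0))).
  elim/big_ind2 : _ => [|u a v b au bv|//]; first by rewrite norm0.
  by rewrite (le_trans (is_norm_triangle hN a b))// lerD.
apply: ler_sum => i _.
by rewrite (is_norm_homogeneous hN) mulrC ler_wpM2l ?norm_ge0// ler_coord_mx_norm.
Qed.

Lemma dist_norm x y : `|N x - N y| <= N (x - y).
Proof.
have le_sub u v : N u - N v <= N (u - v).
  by rewrite lerBlDr -{1}(subrK v u) is_norm_triangle.
by apply/ler_normlP; split; [rewrite opprB -(normN (x - y)) opprB|]; exact: le_sub.
Qed.

(** The constant is the inverse of the minimum of [N] on the sup-norm unit sphere, positive by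
    definiteness; homogeneity carries the bound to all [x]. *)
Lemma coord_le_norm : exists2 c, 0 < c & forall x i, `|x i 0| <= c * N x.
Proof.
(* In dimension 0 the sphere is empty, but there is no coordinate to bound. *)
have [i0 _|d0] := pickP (@predT 'I_d); last first.
  by exists 1 => // x i; have := d0 i.
pose S := [set v : 'rV[R]_d | `|v| = 1]%classic.
have S_normalize (v : 'rV[R]_d) : v != 0 -> S (`|v|^-1 *: v).
  by move=> v0; rewrite /S/= normrZ normfV normr_id mulVf// normr_eq0.
have S0 : (S !=set0)%classic.
  exists (`|const_mx 1 : 'rV[R]_d|^-1 *: const_mx 1); apply: S_normalize.
  by apply/eqP => /matrixP/(_ 0 i0)/eqP; rewrite !mxE oner_eq0.
have cS : compact S.
  apply: bounded_closed_compact.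
    by exists 1; split; [exact: real1|move=> M M1 v /= ->; exact: ltW].
  rewrite (_ : S = (fun v : 'rV_d => `|v|) @^-1` [set 1])%classic//.
  by apply: (continuous_closedP _).1 => [v|]; [exact: norm_continuous|exact: closed_eq].
have [K K0 NK] := norm_le_mx_norm.
(* By the reverse triangle inequality, [N] is [K]-Lipschitz for the sup norm. *)
have cN : continuous (fun v : 'rV[R]_d => N v^T).
  move=> v; apply/(@cvgrPdist_lt _ R^o _ (nbhs v)) => e e0; apply/nbhs_ballP.
  exists (K^-1 * e) => [|t]; first by rewrite /= mulr_gt0 ?invr_gt0.
  rewrite -ball_normE /= ltr_pdivlMl// => /(le_lt_trans _); apply.
  by rewrite (le_trans (dist_norm _ _))// -linearB (le_trans (NK _))//= mx_norm_trmx.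
have [v /set_mem Sv minv] := EVT_min_rV S0 cS (continuous_subspaceT cN).
have m0 : 0 < N v^T.
  apply: norm_gt0; apply/eqP => /(congr1 trmx); rewrite trmxK trmx0 => v0.
  by move: Sv; rewrite /S/= v0 normr0 => /esym/eqP; rewrite oner_eq0.
exists (N v^T)^-1; first by rewrite invr_gt0.
move=> x i; rewrite ler_pdivlMl//.
have [->|x0] := eqVneq x 0; first by rewrite mxE normr0 mulr0 norm_ge0.
apply: (@le_trans _ _ (N v^T * `|x|)).
  by rewrite ler_pM2l// ler_coord_mx_norm.
have xT0 : x^T != 0.
  by apply: contra_neq x0 => /(congr1 trmx); rewrite trmxK trmx0.
have := minv _ (mem_set (S_normalize _ xT0)).
rewrite mx_norm_trmx linearZ/= trmxK (is_norm_homogeneous hN) normfV normr_id.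
by rewrite ler_pdivlMl ?normr_gt0// mulrC.
Qed.

(** Ensures that the [sup] in [dual_norm] is a genuine upper bound rather than a default value. *)
Lemma inner_bounded z : exists c, forall x, N x <= 1 -> inner z x <= c.
Proof.
have [c c0 xc] := coord_le_norm.
exists (\sum_i `|z i 0| * c) => x x1; apply: ler_sum => i _.
rewrite (le_trans (ler_norm _))// normrM ler_wpM2l// (le_trans (xc x i))//.
by rewrite ler_piMr// ltW.
Qed.

Lemma dual_norm_leP z c :
  dual_norm N z <= c <-> forall x, N x <= 1 -> inner z x <= c.
Proof.
split=> [zc x x1|zc].
  apply: le_trans zc; apply: ub_le_sup; last by exists x.
  by have [b zb] := inner_bounded z; exists b => _ [y /zb yb <-].
apply: ge_sup => [|_ [x x1 <-]]; last exact: zc.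
by exists (inner z 0), 0 => //=; rewrite norm0.
Qed.

Lemma inner_le_norm z c x : (forall x, N x <= 1 -> inner z x <= c) ->
  inner z x <= c * N x.
Proof.
move=> zc; have [->|x0] := eqVneq x 0.
  by rewrite norm0 mulr0 -(scale0r 0) innerZr mul0r.
have := zc ((N x)^-1 *: x).
by rewrite norm_normalize// innerZr ler_pdivrMl ?norm_gt0// mulrC; exact.
Qed.

(** Hölder's inequality, by rescaling [x] to the unit sphere. *)
Lemma inner_le_dual_norm z x : inner z x <= dual_norm N z * N x.
Proof. by apply: inner_le_norm; apply/dual_norm_leP. Qed.

(** Plays for [mx_dual_norm] the role of [inner_bounded]: on the unit ball all coordinates of [x]
    and [y] are at most [c] in absolute value. *)
Lemma dual_norm_mulmx_bounded (H : 'M[R]_d) :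
  exists b, forall x, N x <= 1 -> dual_norm N (H *m x) <= b.
Proof.
have [c c0 xc] := coord_le_norm.
have cP x i : N x <= 1 -> `|x i 0| <= c.
  by move=> x1; rewrite (le_trans (xc x i))// ler_piMr// ltW.
exists (\sum_i (\sum_j `|H i j| * c) * c) => x x1; apply/dual_norm_leP => y y1.
apply: ler_sum => i _; rewrite (le_trans (ler_norm _))// normrM ler_pM ?cP//.
rewrite mxE (le_trans (ler_norm_sum _ _ _))//; apply: ler_sum => j _.
by rewrite normrM ler_wpM2l ?cP.
Qed.

Lemma mx_dual_norm_leP (H : 'M[R]_d) c :
  mx_dual_norm N H <= c <->
  forall x y, N x <= 1 -> N y <= 1 -> inner (H *m x) y <= c.
Proof.
split=> [Hc x y x1|Hc].
  move: y; apply/dual_norm_leP; apply: le_trans Hc; apply: ub_le_sup.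
    by have [b Hb] := dual_norm_mulmx_bounded H; exists b => _ [u /Hb ub <-].
  by exists x.
apply: ge_sup => [|_ [x x1 <-]]; last by apply/dual_norm_leP => y; exact: Hc.
by exists (dual_norm N (H *m 0)), 0 => //=; rewrite norm0.
Qed.

Lemma inner_mulmx_le (H : 'M[R]_d) c x y : mx_dual_norm N H <= c ->
  N y <= 1 -> inner (H *m x) y <= c * N x.
Proof.
move=> /mx_dual_norm_leP Hc y1; have [->|x0] := eqVneq x 0.
  by rewrite mulmx0 norm0 mulr0 -(scale0r 0) innerZl mul0r.
have := Hc ((N x)^-1 *: x) y.
rewrite norm_normalize// -scalemxAr innerZl ler_pdivrMl ?norm_gt0// mulrC.
exact.
Qed.

End DualNorm.

(** The differential of each coordinate of [g] is linear, so expanding [v] in the standard basis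
    produces the Jacobian matrix; for [g] the gradient of [f] this is the Hessian. *)
Lemma is_derive_inner {R : realType} {d : nat} (g : 'cV[R]_d -> 'cV[R]_d)
    (x v y : 'cV[R]_d) : differentiable g x ->
  is_derive x v (fun u => inner (g u) y)
    (inner ((\matrix_(i, j) 'D_(delta_mx j 0) (fun u => g u i 0) x) *m v) y).
Proof.
move=> dg.
have dgi i : differentiable (fun u => g u i 0) x.
  exact: (differentiable_comp dg (differentiable_coord _ _ _)).
pose h i : 'cV[R]_d -> R^o := fun u => g u i 0.
have -> : (fun u => inner (g u) y) = \sum_i (y i 0 \*: h i).
  by apply/funext => u; rewrite fct_sumE; apply: eq_bigr => i _; rewrite mulrC.
apply: is_derive_eq.
  apply: is_derive_sum => i; apply: is_deriveZ.
  by apply: derivableP; apply: diff_derivable; exact: dgi.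
apply: eq_bigr => i _; rewrite mulrC mxE; congr (_ * _).
rewrite deriveE; last exact: dgi.
rewrite {1}(matrix_sum_delta v) linear_sum/=.
apply: eq_bigr => j _; rewrite big_ord1 linearZ/= mxE -deriveE; last exact: dgi.
exact: mulrC.
Qed.

(** Both derivatives are limits of the same difference quotient. *)
Lemma is_derive_line {R : realType} {V W : normedModType R} (F : V -> W)
    (x v : V) (t : R) (l : W) : is_derive (t *: v + x) v F l ->
  is_derive t 1 (fun s => F (s *: v + x)) l.
Proof.
have E : (fun h : R =>
    h^-1 *: (F ((h *: (1 : R) + t) *: v + x) - F (t *: v + x))) =
    fun h : R => h^-1 *: (F (h *: v + (t *: v + x)) - F (t *: v + x)).
  by apply/funext => h; rewrite scalerDl addrA /GRing.scale/= mulr1.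
by move=> [dF lF]; split; rewrite /derivable /derive /= E.
Qed.

Theorem proposition3 (R : realType) (d : nat) (N : 'cV[R]_d -> R)
    (hN : is_norm N) (f : 'cV[R]_d -> R) (hf : twice_differentiable f)
    (L : R) (hL : 0 < L) :
  L_smooth N L f <-> (forall x : 'cV[R]_d, mx_dual_norm N (hessian f x) <= L).
Proof.
have [df dg] := hf.
have dI x v y : is_derive x v (fun u => inner (gradient f u) y)
    (inner (hessian f x *m v) y) by exact: is_derive_inner.
split=> [[_ lip] x|Hle].
  apply/(mx_dual_norm_leP hN) => v y v1 y1.
  have [dF <-] := dI x v y; apply: limr_le => //.
  near=> h.
  have h0 : h != 0 by near: h; exact: nbhs_dnbhs_neq.
  (* The factor [h^-1] is moved onto [y], so that after Hölder and the Lipschitz bound its absolute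
     value cancels the one in [N (h *: v)]. *)
  rewrite /= -innerBl -[_ *: _]innerZr.
  rewrite (le_trans (inner_le_dual_norm hN _ _))//.
  rewrite (le_trans (ler_wpM2r (norm_ge0 hN _) (lip _ _)))// addrK.
  rewrite !(is_norm_homogeneous hN) normfV (mulrCA L) mulrACA.
  rewrite mulfV ?normr_eq0// mul1r -mulrA ler_piMr ?(ltW hL)//.
  by rewrite mulr_ile1 ?norm_ge0.
split=> // x x'; apply/(dual_norm_leP hN) => y y1; rewrite innerBl.
(* The quantity to bound is [phi 1 - phi 0], which equals the derivative of [phi] at some point of
   the segment. *)
pose phi (t : R) := inner (gradient f (t *: (x' - x) + x)) y.
have dphi (t : R) : is_derive t 1 phi
    (inner (hessian f (t *: (x' - x) + x) *m (x' - x)) y).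
  exact/(is_derive_line (fun u => inner (gradient f u) y)).
have cphi := @derivable_within_continuous _ _ phi `[0, 1]
  (fun t _ => @ex_derive _ _ _ _ _ _ _ (dphi t)).
have [c _] := MVT_segment ler01 (fun t _ => dphi t) cphi.
rewrite /phi scale1r subrK scale0r add0r subr0 mulr1 => ->.
exact: inner_mulmx_le.
Unshelve. all: by end_near. Qed.
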